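(* Let $B=\left(\frac{e}{\sqrt{2\pi}}\right)^3$. Then the following hold. (1) For all integers $k\ge 1$, $R(3,k)\le \mathrm{TOW}\big(B(k-1)^{1/2},\,2k\big)$. (2) For all integers $k\ge 2$, $R(4,k)\le \mathrm{TOW}\big(1,\,3B(k-2)^{1/2},\,2k-2\big)$. (3) For all integers $k\ge 3$, $R(5,k)\le \mathrm{TOW}\big(1,\,4,\,3B(k-3)^{1/2},\,2k-4\big)$. (4) For every integer $a\ge 6$, for all sufficiently large integers $k$, $$R(a,k)\le \mathrm{TOW}\big(1,\,a-1,\,a-2,\,\ldots,\,4,\,3B(k-a+2)^{1/2},\,2k-2a+6\big),$$ where the arguments following the initial $1$ are the integers $a-1,a-2,\ldots,4$ in decreasing order, followed by $3B(k-a+2)^{1/2}$ and then $2k-2a+6$.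
   Context: For a set $X$ and an integer $a\ge 1$, $\binom{X}{a}$ denotes the set of all $a$-element subsets of $X$, and $[n]=\{1,\dots,n\}$. Given a coloring $COL$ of $\binom{[n]}{a}$, a set $H\subseteq[n]$ is $a$-homogeneous for $COL$ if all elements of $\binom{H}{a}$ have the same color (vacuously true if $|H|<a$). For integers $a,k\ge 1$, $R(a,k)$ denotes the least $n$ such that for every 2-coloring of $\binom{[n]}{a}$ there exists an $a$-homogeneous set $H\subseteq [n]$ with $|H|=k$ (this number exists by Ramsey's theorem). The function $\mathrm{TOW}$ takes a variable number of real arguments and is defined recursively by $\mathrm{TOW}(b)=2^b$ and $\mathrm{TOW}(b_1,\ldots,b_L)=2^{\,b_1\cdot \mathrm{TOW}(b_2,\ldots,b_L)}$ for $L\ge 2$. *)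

(* Defs.v *)
From mathcomp Require Import all_boot.

Set Implicit Arguments.
Unset Strict Implicit.
Unset Printing Implicit Defensive.

Definition subsets_of_size (T : finType) (a : nat) (X : {set T}) : {set {set T}} :=
  [set A : {set T} | (A \subset X) && (#|A| == a)].

(* A 2-coloring of the a-element subsets of T is represented by a map on all
   subsets of T, whose values on subsets of other sizes are never looked at. *)
Definition homogeneous (T : finType) (a : nat) (col : {set T} -> bool)
    (H : {set T}) : bool :=
  [forall A in subsets_of_size a H, forall A' in subsets_of_size a H,
     col A == col A'].

(* The ground set {1, ..., n} is represented by 'I_n. *)
Definition ramsey_prop (a k n : nat) : bool :=
  [forall col : {ffun {set 'I_n} -> bool},
     exists H : {set 'I_n}, (#|H| == k) && homogeneous a col H].

Local Definition mono (T : finType) (a : nat) (col : {set T} -> bool) (c : bool)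
    (H : {set T}) : Prop :=
  forall A : {set T}, A \subset H -> #|A| = a -> col A = c.

Local Lemma ramsey_mono (a k : nat) : exists N, forall (T : finType)
    (col : {set T} -> bool) (S : {set T}), N <= #|S| ->
  exists c, exists H : {set T}, [/\ H \subset S, #|H| = k & mono a col c H].
Proof.
elim: a k => [|a IHa] k.
  exists k => T col S /card_geqP [s [us szs sS]].
  exists (col set0), [set x in s]; split.
  - by apply/subsetP => x; rewrite inE => /sS.
  - by rewrite cardsE (card_uniqP us).
  - by move=> A _ /eqP; rewrite cards_eq0 => /eqP ->.
suff step k1 k2 : exists N, forall (T : finType) (col : {set T} -> bool)
    (S : {set T}), N <= #|S| -> exists c, exists H : {set T},
    [/\ H \subset S, #|H| = (if c then k1 else k2) & mono a.+1 col c H].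
  have [N HN] := step k k; exists N => T col S /(HN T col) [c [H []]].
  by rewrite if_same => ? ? ?; exists c, H.
have [s] := ubnP (k1 + k2); elim: s k1 k2 => // s IHs k1 k2.
have mono0 (T : finType) col c : mono a.+1 col c (@set0 T).
  by move=> A; rewrite subset0 => /eqP ->; rewrite cards0.
case: k1 => [|k1].
  by move=> _; exists 0 => T col S _; exists true, set0; rewrite sub0set cards0.
case: k2 => [|k2] lt_s.
  by exists 0 => T col S _; exists false, set0; rewrite sub0set cards0.
have [|N1 HN1] := IHs k1 k2.+1; first by rewrite -ltnS.
have [|N2 HN2] := IHs k1.+1 k2; first by rewrite -ltnS -addnS.
have [N HN] := IHa (maxn N1 N2).
exists N.+1 => T col S NS.
have [x xS] : exists x, x \in S by apply/card_gt0P; apply: leq_trans NS.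
have NS' : N <= #|S :\ x| by move: NS; rewrite (cardsD1 x) xS add1n.
have [c [H [HS Hsz Hmono]]] := HN T (fun A => col (x |: A)) _ NS'.
have HsubS : H \subset S by apply: subset_trans HS (subD1set _ _).
have extend (H' : {set T}) : H' \subset H -> mono a.+1 col c H' ->
    [/\ x |: H' \subset S, #|x |: H'| = #|H'|.+1 & mono a.+1 col c (x |: H')].
  move=> H'H monoH'.
  have xH' : x \notin H'.
    by apply/negP => /(subsetP H'H)/(subsetP HS); rewrite !inE eqxx.
  split; last 1 first.
  - move=> A AH' szA; case: (boolP (x \in A)) => xA.
      rewrite -(setD1K xA); apply: Hmono.
        by apply: subset_trans H'H; rewrite subDset.
      by move: szA; rewrite (cardsD1 x) xA add1n => -[].
    apply: monoH' => //; apply/subsetP => y yA.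
    move: (subsetP AH' y yA); rewrite !inE => /orP[/eqP yx|//].
    by rewrite -yx yA in xA.
  - by rewrite subUset sub1set xS (subset_trans H'H).
  - by rewrite cardsU1 xH'.
case: c extend {Hmono} => extend.
  have [|c [H' [H'H szH' mH']]] := HN1 T col H; first by rewrite Hsz leq_maxl.
  case: c szH' mH' => szH' mH'.
    by have [] := extend _ H'H mH'; exists true, (x |: H'); rewrite -szH'.
  by exists false, H'; rewrite (subset_trans H'H).
have [|c [H' [H'H szH' mH']]] := HN2 T col H; first by rewrite Hsz leq_maxr.
case: c szH' mH' => szH' mH'.
  by exists true, H'; rewrite (subset_trans H'H).
by have [] := extend _ H'H mH'; exists false, (x |: H'); rewrite -szH'.
Qed.

Lemma ramsey_theorem (a k : nat) : exists n, ramsey_prop a k n.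
Proof.
have [N HN] := ramsey_mono a k; exists N.
apply/forallP => col; apply/existsP.
have [|c [H [_ szH mH]]] := HN _ col [set: 'I_N]; first by rewrite cardsT card_ord.
exists H; rewrite szH eqxx; apply/forall_inP => A; rewrite inE => /andP[AH /eqP szA].
apply/forall_inP => A'; rewrite inE => /andP[A'H /eqP szA'].
by rewrite (mH A) ?(mH A').
Qed.

Definition ramsey (a k : nat) : nat := ex_minn (ramsey_theorem a k).

(* Loaded only now: their set notations shadow those of finset *)
From mathcomp Require Import all_order all_algebra.
From mathcomp Require Import all_classical all_reals all_analysis.

Import GRing.Theory.
Local Open Scope ring_scope.

(* TOW takes at least one argument; its value on the empty list is junk. *)
Fixpoint TOW (R : realType) (s : seq R) : R :=
  match s with
  | [::] => 1
  | [:: b] => 2 `^ b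
  | b :: s' => 2 `^ (b * TOW s')
  end.

(* Main.v *)
(** For triples, points are inserted one after the other into a binary tree
    (Conlon, Fox and Sudakov): a new point [x] descends from the root, and at each
    node [a] the majority colour of the triples [{a, x, y}], [y] among the points
    still available, decides the branch and at least halves the set of available
    points. A path that turns [k - 1] times in the same direction gives a
    homogeneous set, so with [n = k - 1] the tree has at most [C(2n, n) - 1] nodes
    and depth at most [2n], and [2n C(2n, n)] halvings suffice. The estimate
    [C(2n, n)^2 (3n + 1) <= 16^n] brings this below [B sqrt(k - 1) 2^(2k)].

    For larger exponents, a prefix of points on which the colour of an
    [(a+1)]-set does not depend on its last point (Erdos and Rado) gives
    [R(a + 1, k + 1) <= 2 ^ (R(a, k) ^ a)], and each such step adds one level to
    the tower. *)
Require Import Defs.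
From mathcomp Require Import all_boot zify.

Set Implicit Arguments.
Unset Strict Implicit.
Unset Printing Implicit Defensive.

(** * Homogeneous sets and the Ramsey number *)

Lemma homogeneousP (T : finType) (a : nat) (col : {set T} -> bool) (H : {set T}) :
  reflect (forall A A' : {set T}, A \subset H -> A' \subset H ->
             #|A| = a -> #|A'| = a -> col A = col A')
          (homogeneous a col H).
Proof.
apply: (iffP forall_inP) => [hom A A' AH A'H szA szA' | hom A].
  have AsH : A \in subsets_of_size a H by rewrite inE AH szA eqxx.
  have A'sH : A' \in subsets_of_size a H by rewrite inE A'H szA' eqxx.
  by move/forall_inP: (hom A AsH) => /(_ A' A'sH)/eqP.
rewrite inE => /andP[AH /eqP szA]; apply/forall_inP => A'.
by rewrite inE => /andP[A'H /eqP szA']; apply/eqP/hom.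
Qed.

Lemma homogeneous_const (T : finType) (a : nat) (col : {set T} -> bool)
    (c : bool) (H : {set T}) :
  (forall A : {set T}, A \subset H -> #|A| = a -> col A = c) ->
  homogeneous a col H.
Proof.
by move=> colc; apply/homogeneousP => A A' AH A'H szA szA'; rewrite !colc.
Qed.

Lemma ramsey_leq (a k n : nat) :
  (forall col : {set 'I_n} -> bool,
     exists2 H : {set 'I_n}, #|H| = k & homogeneous a col H) ->
  ramsey a k <= n.
Proof.
move=> homn; rewrite /ramsey; case: ex_minnP => m _; apply.
apply/forallP => col; apply/existsP; have [H szH homH] := homn col.
by exists H; rewrite szH eqxx.
Qed.

(** An injection of ['I_n] into [X] pulls the colouring back and pushes the homogeneous set
    forward. *)
Lemma ramsey_homogeneous (a k : nat) (T : finType) (col : {set T} -> bool)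
    (X : {set T}) :
  ramsey a k <= #|X| ->
  exists H : {set T}, [/\ H \subset X, #|H| = k & homogeneous a col H].
Proof.
rewrite /ramsey; case: ex_minnP => n /forallP homn _ le_nX.
pose f (i : 'I_n) : T := enum_val (widen_ord le_nX i).
have f_inj : injective f.
  by move=> i j /enum_val_inj/(congr1 val) /= ?; apply: val_inj.
have /existsP[H /andP[/eqP szH /homogeneousP homH]] :=
  homn [ffun A : {set 'I_n} => col (f @: A)].
exists (f @: H); split; last 1 first.
- have preim (A : {set T}) : A \subset f @: H -> exists2 A' : {set 'I_n},
      A' \subset H & A = f @: A'.
    move=> AH; exists (H :&: f @^-1: A); first exact: subsetIl.
    apply/setP => y; apply/idP/imsetP => [yA | [i]].
      have /imsetP[i iH yi] := subsetP AH y yA.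
      by exists i => //; rewrite !inE iH -yi.
    by rewrite !inE => /andP[_ ?] ->.
  apply/homogeneousP => A B /preim[A' A'H ->] /preim[B' B'H ->].
  rewrite !card_imset // => szA szB.
  by have := homH A' B' A'H B'H szA szB; rewrite !ffunE.
- by apply/subsetP => _ /imsetP[i _ ->]; apply: enum_valP.
- by rewrite card_imset.
Qed.

(** * Halving by majority colour *)

Lemma majority (T : finType) (g : T -> bool) (S : {set T}) :
  exists c, exists S' : {set T},
    [/\ S' \subset S, #|S| <= 2 * #|S'| & {in S', forall y, g y = c}].
Proof.
have := cardsID [set y | g y] S.
have [le_tf cardS | lt_ft cardS] :=
  leqP #|S :\: [set y | g y]| #|S :&: [set y | g y]|.
  exists true, (S :&: [set y | g y]); split; first exact: subsetIl.
    by rewrite -cardS mul2n -addnn leq_add2l.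
  by move=> y; rewrite !inE => /andP[].
exists false, (S :\: [set y | g y]); split; first exact: subsetDl.
  by rewrite -cardS mul2n -addnn leq_add2r ltnW.
by move=> y; rewrite !inE => /andP[/negbTE].
Qed.

Lemma majority_seq (T : finType) (I : eqType) (r : seq I) (g : I -> T -> bool)
    (S : {set T}) :
  exists S' : {set T}, [/\ S' \subset S, #|S| <= 2 ^ size r * #|S'| &
    {in r, forall i, {in S' &, forall y y', g i y = g i y'}}].
Proof.
elim: r S => [|i r IHr] S; first by exists S; rewrite mul1n.
have [c [S1 [S1S leS gc]]] := majority (g i) S.
have [S2 [S2S1 leS1 gr]] := IHr S1; exists S2; split.
- exact: subset_trans S2S1 S1S.
- by apply: leq_trans leS _; rewrite expnS -mulnA leq_mul2l.
move=> j; rewrite inE => /predU1P[-> | /gr //] y y' yS2 y'S2.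
by rewrite !gc // (subsetP S2S1).
Qed.

(** * End-homogeneous sets and the step from [a] to [a + 1] *)

Lemma subset_setU1_notin (T : finType) (A X : {set T}) (x : T) :
  A \subset x |: X -> x \notin A -> A \subset X.
Proof.
move=> AX xA; apply/subsetP => y yA; have := subsetP AX y yA.
by rewrite in_setU1 => /predU1P[yx | //]; rewrite -yx yA in xA.
Qed.

Lemma disjoint_insert (T : finType) (X S S' : {set T}) (x : T) :
  [disjoint X & S] -> S' \subset S :\ x -> [disjoint x |: X & S'].
Proof.
move=> disXS S'S; rewrite disjoint_sym disjoints_subset.
apply/subsetP => z /(subsetP S'S); rewrite !inE => /andP[/negbTE -> zS].
by rewrite (disjointFl disXS zS).
Qed.

(* No order on [X] is needed: for an [(a+1)]-subset [D] of [X] it is enough that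
   some point of [D], in practice the last one chosen, behaves like the points
   of [S]. *)
Definition end_homogeneous (T : finType) (a : nat) (col : {set T} -> bool)
    (X S : {set T}) : Prop :=
  [/\ [disjoint X & S],
      forall A : {set T}, A \subset X -> #|A| = a ->
        {in S &, forall y y', col (y |: A) = col (y' |: A)}
    & forall D : {set T}, D \subset X -> #|D| = a.+1 ->
        exists2 x, x \in D & {in S, forall y, col D = col (y |: D :\ x)}].

(** Only sets [x |: A] with [A] an [a]-subset of [X] impose new conditions, so one halving for each
    such [A] suffices. A new [D] containing [x] has [x] itself as its special point. *)
Lemma end_homogeneous_step (T : finType) (a : nat) (col : {set T} -> bool)
    (X S : {set T}) (x : T) :
  end_homogeneous a.+1 col X S -> x \in S ->
  exists S' : {set T}, [/\ S' \subset S :\ x,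
    #|S :\ x| <= 2 ^ 'C(#|X|, a) * #|S'| & end_homogeneous a.+1 col (x |: X) S'].
Proof.
move=> [disXS colS colX] xS.
pose r := enum [set A : {set T} | A \subset X & #|A| == a].
have [S' [S'S leS colS']] :=
  majority_seq r (fun A y => col (y |: (x |: A))) (S :\ x).
have S'S0 : S' \subset S by apply: subset_trans S'S (subD1set _ _).
have size_r : size r = 'C(#|X|, a) by rewrite -cardE cards_draws.
have sub_x (A : {set T}) : A \subset x |: X -> A :\ x \subset X.
  by rewrite subDset.
exists S'; split=> //; first by rewrite -size_r.
split.
- exact: disjoint_insert disXS S'S.
- move=> A AX szA y y' yS' y'S'.
  have [xA | xA] := boolP (x \in A); last first.
    by apply: colS; rewrite ?(subsetP S'S0) // (subset_setU1_notin AX).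
  rewrite -(setD1K xA); apply: colS' => //.
  rewrite mem_enum inE sub_x //.
  by move: szA; rewrite (cardsD1 x) xA => -[/eqP].
- move=> D DX szD; have [xD | xD] := boolP (x \in D); last first.
    have [|z zD colD] := colX D _ szD; first exact: subset_setU1_notin DX xD.
    by exists z => // y /(subsetP S'S0); apply: colD.
  exists x => // y yS'; rewrite -{1}(setD1K xD).
  have szD' : #|D :\ x| = a.+1 by move: szD; rewrite (cardsD1 x) xD => -[].
  by apply: colS => //; [exact: sub_x | exact: (subsetP S'S0)].
Qed.

Lemma bin_leq_exp (n m : nat) : 'C(n, m) <= n ^ m.
Proof.
elim: m n => [|m IHm] [|n]; rewrite ?bin0 ?bin0n //.
rewrite -(leq_pmul2l (ltn0Sn m)) -mul_bin_diag.
apply: leq_trans (_ : n.+1 * n.+1 ^ m <= _).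
  rewrite leq_mul2l (leq_trans (IHm n)) //.
  by case: m {IHm} => // m; rewrite leq_exp2r.
by rewrite -expnS leq_pmull.
Qed.

(** Passing from [j] to [j + 1] points will cost at most [j ^ a.+1 + 1] halvings; consecutive powers
    differ by at least that much. *)
Lemma expnS_lower_bound (j a : nat) :
  j ^ a.+2 + j ^ a.+1 + 1 <= j.+1 ^ a.+2.
Proof.
have geS : j ^ a.+1 + 1 <= j.+1 ^ a.+1 by rewrite addn1 ltn_exp2r.
by rewrite [j ^ _]expnS [j.+1 ^ a.+2]expnS; nia.
Qed.

(** Removing one point is absorbed by rounding: [s' < q] would give [p * s' + p <= p * q <= s + 1 <=
    p * s' + 1]. *)
Lemma quotient_lower_bound (p q s s' : nat) :
  1 < p -> p * q <= s.+1 -> s <= p * s' -> q <= s'.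
Proof. by move=> p_gt1 le_s le_s'; rewrite leqNgt; apply/negP; nia. Qed.

Lemma end_homogeneous_extend (T : finType) (a M : nat) (col : {set T} -> bool)
    (X S : {set T}) :
  end_homogeneous a.+2 col X S -> #|X| <= M ->
  2 ^ (M ^ a.+2 - #|X| ^ a.+2) <= #|S| ->
  exists X' S' : {set T},
    [/\ #|X'| = M, S' != set0 & end_homogeneous a.+2 col X' S'].
Proof.
have [d] := ubnP (M - #|X|); elim: d X S => // d IHd X S lt_d homXS.
rewrite leq_eqVlt => /predU1P[cardX le_S | lt_XM le_S].
  exists X, S; split=> //; rewrite -card_gt0.
  by apply: leq_trans le_S; rewrite expn_gt0.
have [x xS] : exists x, x \in S.
  by apply/card_gt0P; apply: leq_trans le_S; rewrite expn_gt0.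
have [S' [S'S le_S' homS']] := end_homogeneous_step homXS xS.
have xX : x \notin X.
  by case: homXS => /disjointFl ->.
have cardX' : #|x |: X| = #|X|.+1 by rewrite cardsU1 xX.
apply: (IHd (x |: X) S') => //; rewrite cardX' //; first by lia.
(* One halving more than needed keeps the factor above 1 even when the binomial coefficient is 0. *)
apply: (@quotient_lower_bound (2 ^ 'C(#|X|, a.+1).+1)) (leq_trans le_S' _).
- by rewrite (@leq_exp2l 2 1).
- have <- : #|S| = #|S :\ x|.+1 by rewrite (cardsD1 x) xS.
  apply: leq_trans le_S; rewrite -expnD leq_exp2l //.
  have := bin_leq_exp #|X| a.+1.
  have := expnS_lower_bound #|X| a.
  have : #|X|.+1 ^ a.+2 <= M ^ a.+2 by rewrite leq_exp2r.
  by lia.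
- by rewrite leq_mul2r leq_exp2l // leqnSn orbT.
Qed.

(** Once [X] has [M] points and [y] is left over, a homogeneous subset of [X] for
    [A |-> col (y |: A)] remains homogeneous for [col] when [y] joins it. *)
Theorem ramsey_step (a k : nat) :
  ramsey a.+3 k.+1 <= 2 ^ (ramsey a.+2 k) ^ a.+2.
Proof.
set M := ramsey a.+2 k; apply: ramsey_leq => col.
have [|||X [S [cardX /set0Pn[y yS] [disXS _ colX]]]] :=
    @end_homogeneous_extend _ a M col set0 setT.
- split=> [|A|D]; first by rewrite disjoints_subset sub0set.
    by rewrite subset0 => /eqP->; rewrite cards0.
  by rewrite subset0 => /eqP->; rewrite cards0.
- by rewrite cards0.
- by rewrite cards0 exp0n // subn0 cardsT card_ord.
have [|H [HX cardH /homogeneousP homH]] :=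
  @ramsey_homogeneous a.+2 k _ (fun A => col (y |: A)) X; first by rewrite cardX.
have yH : y \notin H.
  by apply/negP => /(subsetP HX) yX; rewrite (disjointFr disXS yX) in yS.
exists (y |: H); first by rewrite cardsU1 yH cardH.
have reduce (D : {set 'I__}) : D \subset y |: H -> #|D| = a.+3 ->
    exists A : {set 'I_(2 ^ M ^ a.+2)}, [/\ A \subset H, #|A| = a.+2 & col D = col (y |: A)].
  move=> DH szD; have [yD | yD] := boolP (y \in D).
    exists (D :\ y); rewrite subDset setD1K //; split=> //.
    by move: szD; rewrite (cardsD1 y) yD => -[].
  have DH' := subset_setU1_notin DH yD.
  have [|x xD colD] := colX D _ szD; first exact: subset_trans HX.
  exists (D :\ x); split; last exact: colD.
    exact: subset_trans (subD1set _ _) DH'.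
  by move: szD; rewrite (cardsD1 x) xD => -[].
apply/homogeneousP => D D' /reduce redD /reduce redD' /redD [A [AH szA ->]].
by move=> /redD' [A' [A'H szA' ->]]; apply: homH.
Qed.

(** * Triples: the binary tree of insertions *)

Section Triples.
Variables (T : finType) (col : {set T} -> bool) (m : nat).
Implicit Types (X Y S : {set T}) (c : bool) (p q : nat) (a x y : T).

Definition clique c X S : Prop :=
  [/\ [disjoint X & S],
      forall D : {set T}, D \subset X -> #|D| = 3 -> col D = c
    & forall A : {set T}, A \subset X -> #|A| = 2 ->
        {in S, forall y, col (y |: A) = c}].

Lemma cliqueW c X S S' : S' \subset S -> clique c X S -> clique c X S'.
Proof.
move=> S'S [disXS col3 col2]; split=> //; first exact: disjointWr S'S disXS.
by move=> A AX szA y /(subsetP S'S); apply: col2.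
Qed.

Lemma clique_win c X S x :
  clique c X S -> x \in S -> #|X| = m ->
  exists2 H : {set T}, #|H| = m.+1 & homogeneous 3 col H.
Proof.
move=> [disXS col3 col2] xS cardX; exists (x |: X).
  by rewrite cardsU1 (disjointFl disXS xS) cardX.
apply: (@homogeneous_const _ _ _ c) => D DX szD.
have [xD | xD] := boolP (x \in D); last first.
  exact/col3/szD/(subset_setU1_notin DX).
rewrite -(setD1K xD); apply: col2 => //; first by rewrite subDset.
by move: szD; rewrite (cardsD1 x) xD => -[].
Qed.

Lemma clique_insert c X S S' x :
  clique c X S -> x \in S -> S' \subset S :\ x ->
  (forall a, a \in X -> {in S', forall y, col (y |: (x |: [set a])) = c}) ->
  clique c (x |: X) S'.
Proof.
move=> [disXS col3 col2] xS S'S colx.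
split; first exact: disjoint_insert disXS S'S.
- move=> D DX szD; have [xD | xD] := boolP (x \in D); last first.
    exact/col3/szD/(subset_setU1_notin DX).
  rewrite -(setD1K xD); apply: col2 => //; first by rewrite subDset.
  by move: szD; rewrite (cardsD1 x) xD => -[].
- move=> A AX szA y yS'; have [xA | xA] := boolP (x \in A).
    have /cards1P[a Aa] : #|A :\ x| == 1.
      by move: szA; rewrite (cardsD1 x) xA => -[/eqP].
    rewrite -(setD1K xA) Aa; apply: colx => //.
    by have := AX; rewrite -subDset Aa sub1set.
  apply: col2 => //; first exact: subset_setU1_notin AX xA.
  by apply: subsetP yS'; apply: subset_trans S'S (subD1set _ _).
Qed.

Inductive tree := Leaf | Node of T & tree & tree.

(* [X] and [Y] are the ancestors from which the current node is reached by a
   [true], resp. [false], edge; [p] and [q] are how many more of each kind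
   produce a homogeneous set. *)
Fixpoint exposed p q X Y (t : tree) S : Prop :=
  match t with
  | Leaf => [/\ #|X| + p = m, #|Y| + q = m, clique true X S & clique false Y S]
  | Node a l r => [/\ 0 < p, 0 < q, exposed p.-1 q (a |: X) Y l S
                    & exposed p q.-1 X (a |: Y) r S]
  end.

(* How many nodes can still be added: there are ['C(p + q, p) - 1] words with
   fewer than [p] letters [true] and fewer than [q] letters [false]. *)
Fixpoint vacancies p q (t : tree) : nat :=
  match t with
  | Leaf => 'C(p + q, p).-1
  | Node a l r => vacancies p.-1 q l + vacancies p q.-1 r
  end.

Lemma exposedW p q X Y t S S' :
  S' \subset S -> exposed p q X Y t S -> exposed p q X Y t S'.
Proof.
move=> S'S; elim: t p q X Y => [|a l IHl r IHr] p q X Y /=.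
  by move=> [? ? ? ?]; split=> //; apply: cliqueW S'S _.
by move=> [? ? ? ?]; split=> //; [apply: IHl | apply: IHr].
Qed.

(** Induction along the descent of [x]: at a node [a], the majority colour of [{a, x, y}] picks the
    child, halves [S1] and lowers [p + q] by one. The conditions on [X] and [Y] record the colours
    fixed at the ancestors already passed. *)
Lemma exposed_insert p q X Y t S S1 x :
  exposed p q X Y t S -> x \in S -> S1 \subset S :\ x ->
  (forall a, a \in X -> {in S1, forall y, col (y |: (x |: [set a])) = true}) ->
  (forall a, a \in Y -> {in S1, forall y, col (y |: (x |: [set a])) = false}) ->
  (exists2 H : {set T}, #|H| = m.+1 & homogeneous 3 col H) \/
  exists t' S', [/\ S' \subset S1, #|S1| <= 2 ^ (p + q) * #|S'|,
    exposed p q X Y t' S' & vacancies p q t = (vacancies p q t').+1].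
Proof.
move=> + xS; elim: t p q X Y S1 => [|a l IHl r IHr] p q X Y S1 /=.
  move=> [cardX cardY cliX cliY] S1S colX colY.
  have [p0 | p_gt0] := posnP p.
    by left; apply: clique_win cliX xS _; rewrite -cardX p0 addn0.
  have [q0 | q_gt0] := posnP q.
    by left; apply: clique_win cliY xS _; rewrite -cardY q0 addn0.
  right; exists (Node x Leaf Leaf), S1; split=> //.
  - by rewrite leq_pmull // expn_gt0.
  - have S1S' : S1 \subset S by apply: subset_trans S1S (subD1set _ _).
    have [disX _ _] := cliX; have [disY _ _] := cliY.
    split=> //; split.
    + by rewrite cardsU1 (disjointFl disX xS) -cardX; lia.
    + by [].
    + exact: clique_insert cliX xS S1S colX.
    + exact: cliqueW S1S' cliY.
    + by [].
    + by rewrite cardsU1 (disjointFl disY xS) -cardY; lia.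
    + exact: cliqueW S1S' cliX.
    + exact: clique_insert cliY xS S1S colY.
  (* Pascal's rule: one vacancy is filled, the others split between the two new leaves. Positivity
     keeps the predecessors from truncating. *)
  - case: p q p_gt0 q_gt0 {cardX cardY} => [//|p] [//|q] _ _ /=.
    have ? : 0 < 'C(p + q.+1, p) by rewrite bin_gt0 leq_addr.
    have ? : 0 < 'C(p + q.+1, p.+1) by rewrite bin_gt0 addnS ltnS leq_addr.
    by rewrite (addSn p q.+1) binS (addSnnS p q); lia.
move=> [p_gt0 q_gt0 expl expr] S1S colX colY.
have [c [S2 [S2S1 leS1 colS2]]] := majority (fun y => col (y |: (x |: [set a]))) S1.
have S2S : S2 \subset S :\ x by apply: subset_trans S2S1 S1S.
have sub_S S' : S' \subset S2 -> S' \subset S.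
  by move=> S'S2; apply: subset_trans (subset_trans S'S2 S2S) (subD1set _ _).
case: c colS2 => colS2.
  have [||win|[l' [S' [S'S2 leS2 expl' vacl]]]] := IHl _ _ _ _ _ expl S2S.
  - move=> b; rewrite in_setU1 => /predU1P[-> // | bX] y /(subsetP S2S1).
    exact: colX.
  - by move=> b bY y /(subsetP S2S1); apply: colY.
  - by left.
  right; exists (Node a l' r), S'; split; first exact: subset_trans S'S2 S2S1.
  - by case: p p_gt0 {expl expr expl' vacl} leS2 => // p _ /= leS2; rewrite addSn expnS; nia.
  - by split=> //; apply: exposedW expr; apply: sub_S.
  - by rewrite /= vacl.
have [||win|[r' [S' [S'S2 leS2 expr' vacr]]]] := IHr _ _ _ _ _ expr S2S.
- by move=> b bX y /(subsetP S2S1); apply: colX.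
- move=> b; rewrite in_setU1 => /predU1P[-> // | bY] y /(subsetP S2S1).
  exact: colY.
- by left.
right; exists (Node a l r'), S'; split; first exact: subset_trans S'S2 S2S1.
- by case: q q_gt0 {expl expr expr' vacr} leS2 => // q _ /= leS2; rewrite addnS expnS; nia.
- by split=> //; apply: exposedW expl; apply: sub_S.
- by rewrite /= vacr addnS.
Qed.

(** Each insertion fills a vacancy at the cost of [2 * m] halvings; with no vacancy left, an
    insertion must produce the homogeneous set. Positivity of [m] makes the factor [2 ^ (m + m)]
    exceed 1. *)
Lemma exposed_win t S :
  exposed m m set0 set0 t S -> (0 < m) || (vacancies m m t == 0) ->
  2 ^ (2 * m * vacancies m m t) <= #|S| ->
  exists2 H : {set T}, #|H| = m.+1 & homogeneous 3 col H.
Proof.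
move vac_n: (vacancies m m t) => n; elim: n t S vac_n => [|n IHn] t S vac_n expS m_gt0 leS.
  have [x xS] : exists x, x \in S.
    by apply/card_gt0P; apply: leq_trans leS; rewrite expn_gt0.
  have [a|a|//|[t' [S' [_ _ _]]]] := exposed_insert expS xS (subxx _).
  - by rewrite inE.
  - by rewrite inE.
  by rewrite vac_n.
have [x xS] : exists x, x \in S.
  by apply/card_gt0P; apply: leq_trans leS; rewrite expn_gt0.
have [a|a|//|[t' [S' [_ leS' expS']]]] := exposed_insert expS xS (subxx _).
- by rewrite inE.
- by rewrite inE.
rewrite vac_n => -[/esym vac'].
rewrite orbF in m_gt0; apply: IHn vac' expS' _ _; first by rewrite m_gt0.
apply: (@quotient_lower_bound (2 ^ (m + m))) leS'.
  by rewrite (@ltn_exp2l 2 0) // addn_gt0 m_gt0.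
have <- : #|S| = #|S :\ x|.+1 by rewrite (cardsD1 x) xS.
by apply: leq_trans leS; rewrite -expnD leq_exp2l // addnn -mul2n mulnS.
Qed.

End Triples.

Theorem ramsey3_leq (n : nat) : ramsey 3 n.+1 <= 2 ^ (2 * n * 'C(2 * n, n)).
Proof.
apply: ramsey_leq => col.
have clique0 c : clique col c set0 setT.
  split=> [|D|A]; first by rewrite disjoints_subset sub0set.
    by rewrite subset0 => /eqP->; rewrite cards0.
  by rewrite subset0 => /eqP->; rewrite cards0.
apply: (@exposed_win _ col n (Leaf _) setT) => /=.
- by rewrite cards0.
- by case: n {col clique0}.
- by rewrite cardsT card_ord leq_exp2l // addnn -mul2n leq_mul2l leq_pred orbT.
Qed.

(** * Numerical estimates and towers *)

Lemma central_binomial_bound (n : nat) : 'C(2 * n, n) ^ 2 * (3 * n + 1) <= 16 ^ n.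
Proof.
elim: n => [//|n IHn].
have binE : n.+1 * 'C(2 * n.+1, n.+1) = 2 * (2 * n + 1) * 'C(2 * n, n).
  have -> : 2 * n.+1 = (2 * n).+2 by lia.
  have sym : 'C((2 * n).+1, n) = 'C((2 * n).+1, n.+1).
    by rewrite -bin_sub; [congr 'C(_, _); lia | lia].
  have := mul_bin_diag (2 * n).+1 n; rewrite [in 'C(_.+2, _)]binS sym /=; lia.
have ? : 0 < n.+1 ^ 2 by rewrite expn_gt0.
(* What remains is [(2n+1)^2 (3n+4) <= 4 (n+1)^2 (3n+1)], whose sides differ by exactly [n]. *)
rewrite -(leq_pmul2l (_ : 0 < n.+1 ^ 2)) // mulnA -expnMn binE.
rewrite (expnS 16); nia.
Qed.

From mathcomp Require Import all_order all_algebra.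
From mathcomp Require Import all_classical all_reals all_analysis.
From mathcomp Require Import ring lra.

Import Order.TTheory GRing.Theory Num.Theory.
Local Open Scope ring_scope.

Lemma TOW_cons (R : realType) (b : R) (s : seq R) :
  s != [::] -> TOW (b :: s) = 2 `^ (b * TOW s).
Proof. by case: s. Qed.

Lemma natrX_powR (R : realType) (n : nat) : (2 ^ n)%:R = 2 `^ n%:R :> R.
Proof. by rewrite natrX powR_mulrn. Qed.

(** The power [a.+2] in [ramsey_step] becomes a factor of the exponent, hence an argument of the
    tower. *)
Lemma ramsey_step_powR (R : realType) (a k : nat) (x : R) :
  (ramsey a.+2 k)%:R <= 2 `^ x ->
  (ramsey a.+3 k.+1)%:R <= 2 `^ (2 `^ (a.+2%:R * x)).
Proof.
move=> le_x.
have : (ramsey a.+3 k.+1)%:R <= (2 ^ ramsey a.+2 k ^ a.+2)%:R :> R.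
  by rewrite ler_nat ramsey_step.
move=> /le_trans; apply; rewrite natrX_powR ler_powR ?ler1n //.
by rewrite mulrC powRrM natrX powR_mulrn ?powR_ge0 // lerXn2r ?nnegrE ?powR_ge0.
Qed.

(** The crude bounds [e >= 2] and [pi <= 4] give [(e^2 / (2 pi))^3 >= (4 / 8)^3]. *)
Lemma towerB_sqr_ge (R : realType) :
  1 / 8 <= ((expR 1 / Num.sqrt (2 * pi)) ^+ 3) ^+ 2 :> R.
Proof.
have pi4 : 2 * pi <= 8 :> R by have := pihalf_lt2 R; lra.
have pi0 : 0 < 2 * pi :> R by have := pi_gt0 R; lra.
have e2 : 4 <= expR 1 ^+ 2 :> R by have := expR_ge1Dx (1 : R); nra.
rewrite exprAC expr_div_n (sqr_sqrtr (ltW pi0)).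
have : 1 / 2 <= expR 1 ^+ 2 / (2 * pi) :> R by rewrite ler_pdivlMr //; lra.
set y := _ ^+ 2 / _ => y2.
have y3 : (1 / 2) ^+ 3 <= y ^+ 3 by rewrite lerXn2r ?nnegrE //; lra.
by apply: le_trans y3; rewrite !exprS expr0; lra.
Qed.

Lemma ramsey3_TOW (R : realType) (k : nat) : (1 <= k)%N ->
  (ramsey 3 k)%:R <= TOW [:: (expR 1 / Num.sqrt (2 * pi)) ^+ 3
                             * Num.sqrt (k%:R - 1 : R); 2 * k%:R].
Proof.
case: k => // n _; set B := (_ / _) ^+ 3.
have B0 : 0 <= B by rewrite exprn_ge0 // divr_ge0 ?expR_ge0 ?sqrtr_ge0.
have -> : n.+1%:R - 1 = n%:R :> R by rewrite -natr1 addrK.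
have : (ramsey 3 n.+1)%:R <= (2 ^ (2 * n * 'C(2 * n, n)))%:R :> R.
  by rewrite ler_nat ramsey3_leq.
move=> /le_trans; apply; rewrite natrX_powR /= ler_powR ?ler1n //.
rewrite -natrM powR_mulrn //.
(* Squaring the exponents removes the root; the claim then reduces to [2 <= 16 B^2]. *)
rewrite -ler_sqr ?nnegrE ?mulr_ge0 ?sqrtr_ge0 ?exprn_ge0 //.
rewrite (exprMn _ (B * _)) (exprMn _ B) sqr_sqrtr // -[_%:R ^+ 2]natrX.
have bound : ((2 * n * 'C(2 * n, n)) ^ 2 <= 2 * (n * 16 ^ n))%N.
  by have := central_binomial_bound n; nia.
apply: (@le_trans _ _ (2 * (n * 16 ^ n))%:R); first by rewrite ler_nat.
have -> : (2 ^+ (2 * n.+1)) ^+ 2 = 16 * (16 ^ n)%:R :> R.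
  by rewrite natrX -exprS (exprM 2 2) exprAC -natrX -natrX.
rewrite !natrM; have := towerB_sqr_ge R; rewrite -/B => B8.
have -> : B ^+ 2 * n%:R * (16 * (16 ^ n)%:R) = B ^+ 2 * 16 * (n%:R * (16 ^ n)%:R).
  by ring.
by rewrite ler_wpM2r ?mulr_ge0 //; lra.
Qed.

(** Here [b] is [a - 4]. Each step raises [a] and [k] together, so the last two arguments, which
    depend only on [k - a], stay fixed. *)
Lemma ramsey_TOW (R : realType) (b k : nat) : (b + 2 <= k)%N ->
  (ramsey (b + 4) k)%:R <=
    TOW (1 :: [seq j%:R | j <- rev (iota 4 b)]
         ++ [:: 3 * (expR 1 / Num.sqrt (2 * pi)) ^+ 3
                  * Num.sqrt (k%:R - (b + 4)%:R + 2 : R);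
                2 * k%:R - 2 * (b + 4)%:R + 6]).
Proof.
elim: b k => [|b IHb] [|k] // le_bk.
  (* The factor 3 in [3 * B] is the exponent in the step from triples to quadruples. *)
  have := ramsey_step_powR (@ramsey3_TOW R k le_bk).
  rewrite /= mul1r -!mulrA.
  have -> : k.+1%:R - (0 + 4)%:R + 2 = k%:R - 1 :> R by rewrite -natr1; lra.
  have -> : 2 * k.+1%:R - 2 * (0 + 4)%:R + 6 = 2 * k%:R :> R by rewrite -natr1; lra.
  by [].
have {IHb} := IHb k le_bk.
have -> : k.+1%:R - (b.+1 + 4)%:R + 2 = k%:R - (b + 4)%:R + 2 :> R.
  by rewrite addSn -!natr1; lra.
have -> : 2 * k.+1%:R - 2 * (b.+1 + 4)%:R + 6 = 2 * k%:R - 2 * (b + 4)%:R + 6 :> R.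
  by rewrite addSn -!natr1; lra.
have -> : iota 4 b.+1 = rcons (iota 4 b) (b + 4)%N.
  by rewrite -[b.+1]addn1 iotaD cats1 addnC.
rewrite rev_rcons map_cons cat_cons.
set s := _ ++ _ => le_s.
have s0 : s != [::] by rewrite -size_eq0 size_cat addn2.
(* The step turns the leading 1 into [b + 4] and puts a new 1 in front. *)
rewrite TOW_cons // mul1r TOW_cons //.
move: le_s; rewrite TOW_cons // mul1r !addn4.
exact: ramsey_step_powR.
Qed.

Theorem theorem6p6 (R : realType) :
  let B : R := (expR 1 / Num.sqrt (2 * pi)) ^+ 3 in
  [/\ (forall k : nat, (1 <= k)%N ->
        (ramsey 3 k)%:R <= TOW [:: B * Num.sqrt (k%:R - 1); 2 * k%:R]),
      (forall k : nat, (2 <= k)%N ->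
        (ramsey 4 k)%:R
          <= TOW [:: 1; 3 * B * Num.sqrt (k%:R - 2); 2 * k%:R - 2]),
      (forall k : nat, (3 <= k)%N ->
        (ramsey 5 k)%:R
          <= TOW [:: 1; 4; 3 * B * Num.sqrt (k%:R - 3); 2 * k%:R - 4])
    & (forall a : nat, (6 <= a)%N ->
        exists k0 : nat, forall k : nat, (k0 <= k)%N ->
        (ramsey a k)%:R
          <= TOW (1 :: [seq j%:R | j <- rev (iota 4 (a - 4))]
                  ++ [:: 3 * B * Num.sqrt (k%:R - a%:R + 2);
                         2 * k%:R - 2 * a%:R + 6]))].
Proof.
move=> B; split=> [k|k le2k|k le3k|a le6a].
- exact: ramsey3_TOW.
- have := @ramsey_TOW R 0 k le2k.
  have -> : k%:R - (0 + 4)%:R + 2 = k%:R - 2 :> R by lra.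
  by have -> : 2 * k%:R - 2 * (0 + 4)%:R + 6 = 2 * k%:R - 2 :> R by lra.
- have := @ramsey_TOW R 1 k le3k.
  have -> : k%:R - (1 + 4)%:R + 2 = k%:R - 3 :> R by lra.
  by have -> : 2 * k%:R - 2 * (1 + 4)%:R + 6 = 2 * k%:R - 4 :> R by lra.
(* The bound holds from [k = a - 2] on, so [k0 = a] works. *)
exists a => k le_ak; have := @ramsey_TOW R (a - 4) k.
by rewrite subnK; [apply; lia | lia].
Qed.
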